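(* Let $p<q$ be positive integers, let $\mathcal{V}^q$ be the inner product space of random variables described in the context, and let $X_i=\bm a_i^\top\circ\bm Z\in\mathcal{V}^q$ with $\bm a_i\in\mathbb{R}^q$, for $i=1,\ldots,p$. Write $\bm X_p=(X_1,\ldots,X_p)^\top$. Consider the closed subspace $$\mathcal{V}_A=\{\bm b^\top\circ\bm X_p:\ \bm b\in\mathbb{R}^p\},\qquad \bm b^\top\circ\bm X_p:=b_1\circ X_1\oplus\cdots\oplus b_p\circ X_p,$$ that is, the subspace of $\mathcal{V}^q$ spanned by $\{X_1,\ldots,X_p\}$, and its orthogonal complement $$\mathcal{V}_A^\perp=\{X\in\mathcal{V}^q:\ \langle X,Y\rangle=0\ \text{ for all } Y\in\mathcal{V}_A\}.$$ Then for every $X\in\mathcal{V}^q$: (1) There exists a unique element $\widehat X\in\mathcal{V}_A$ such that $$\|X\ominus\widehat X\|_{\mathcal{V}^q}=\inf_{Y\in\mathcal{V}_A}\|X\ominus Y\|_{\mathcal{V}^q}.$$ (2) $\widehat X\in\mathcal{V}_A$ and $\|X\ominus\widehat X\|_{\mathcal{V}^q}=\inf_{Y\in\mathcal{V}_A}\|X\ominus Y\|_{\mathcal{V}^q}$ if and only if $\widehat X\in\mathcal{V}_A$ and $X\ominus\widehat X\in\mathcal{V}_A^\perp$.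
   Context: Transformed-linear operations. Let $t(y)=\log\{1+\exp(y)\}$, a monotone bijection from $\mathbb{R}$ onto $(0,\infty)$, with inverse $t^{-1}(x)=\log\{\exp(x)-1\}$. For positive $x_1,x_2$ and $a\in\mathbb{R}$ set $x_1\oplus x_2=t\{t^{-1}(x_1)+t^{-1}(x_2)\}$, $a\circ x_1=t\{a\,t^{-1}(x_1)\}$, and $x_1\ominus x_2=t\{t^{-1}(x_1)-t^{-1}(x_2)\}$. The noise vector. Fix $\alpha>0$. Let $\bm Z=(Z_1,\ldots,Z_q)^\top$ be a vector of independent nonnegative random variables which are regularly varying with tail index $\alpha$ and have unit scale under a common normalizing function $b(s)\to\infty$ (as $s\to\infty$): for each $j$ and each $x>0$, $\lim_{s\to\infty}s\,\mathrm{P}(Z_j>x\,b(s))=x^{-\alpha}$. Each $Z_j$ also satisfies the lower tail condition: for all $c<0$, $s\,\mathrm{P}\{Z_j\le\exp(c\,b(s))\}\to0$ as $s\to\infty$ (in particular $Z_j>0$ almost surely). The space $\mathcal{V}^q$. For $\bm a\in\mathbb{R}^q$ define the random variable $\bm a^\top\circ\bm Z=a_1\circ Z_1\oplus\cdots\oplus a_q\circ Z_q=t\big(\sum_{j=1}^q a_j t^{-1}(Z_j)\big)$, and let $\mathcal{V}^q=\{\bm a^\top\circ\bm Z:\ \bm a\in\mathbb{R}^q\}$, with random variables identified when almost surely equal. Each element of $\mathcal{V}^q$ is uniquely determined by its coefficient vector $\bm a$. For $X_1=\bm a_1^\top\circ\bm Z$, $X_2=\bm a_2^\top\circ\bm Z$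 and $c\in\mathbb{R}$, the vector space operations are $X_1\oplus X_2=(\bm a_1+\bm a_2)^\top\circ\bm Z$, $c\circ X_1=(c\,\bm a_1)^\top\circ\bm Z$, and $X_1\ominus X_2=(\bm a_1-\bm a_2)^\top\circ\bm Z$. The inner product is $\langle X_1,X_2\rangle:=\bm a_1^\top\bm a_2=\sum_{j=1}^q a_{1j}a_{2j}$ and the norm is $\|X\|_{\mathcal{V}^q}=\sqrt{\langle X,X\rangle}$. *)

(* Defs.v *)
From HB Require Import structures.
From mathcomp Require Import all_boot all_order all_algebra.
From mathcomp Require Import all_classical all_reals all_analysis.
From mathcomp Require Import measurable_realfun.

Set Implicit Arguments.
Unset Strict Implicit.
Unset Printing Implicit Defensive.

Import Order.TTheory GRing.Theory Num.Theory.
Import numFieldNormedType.Exports.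

Local Open Scope classical_set_scope.
Local Open Scope ring_scope.
Local Open Scope quotient_scope.

Section transformed_linear_operations.
Context {R : realType}.
Implicit Types x y a : R.

Definition tl (y : R) : R := ln (1 + expR y).

(* Only meaningful for [0 < x]: [ln] is [0] on nonpositive reals. *)
Definition tlinv (x : R) : R := ln (expR x - 1).

Definition tladd x y : R := tl (tlinv x + tlinv y).
Definition tlscale a x : R := tl (a * tlinv x).
Definition tlsub x y : R := tl (tlinv x - tlinv y).

Lemma tl_gt0 y : 0 < tl y.
Proof. by rewrite ln_gt0// ltrDl expR_gt0. Qed.

Lemma tlK : cancel tl tlinv.
Proof.
move=> y; rewrite /tlinv /tl lnK; last by rewrite posrE addr_gt0// expR_gt0.
by rewrite addrC addKr expRK.
Qed.

Lemma tlinvK x : 0 < x -> tl (tlinv x) = x.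
Proof.
move=> x0; rewrite /tlinv /tl lnK; last by rewrite posrE subr_gt0 expR_gt1.
by rewrite addrC subrK expRK.
Qed.

Lemma measurable_tl : measurable_fun [set: R] tl.
Proof.
apply: (@measurableT_comp _ _ _ _ _ _ (@ln R)); first exact: measurable_ln.
by apply: measurable_funD => //; exact: measurable_expR.
Qed.

Lemma measurable_tlinv : measurable_fun [set: R] tlinv.
Proof.
apply: (@measurableT_comp _ _ _ _ _ _ (@ln R)); first exact: measurable_ln.
by apply: measurable_funB => //; exact: measurable_expR.
Qed.

End transformed_linear_operations.

Section random_variables.
Context {R : realType} {d : measure_display} {T : measurableType d}.
Implicit Types (f g : {mfun T >-> R}) (a : R).

Definition rv_add f g : T -> R := fun w => tladd (f w) (g w).
Definition rv_scale a f : T -> R := fun w => tlscale a (f w).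
Definition rv_sub f g : T -> R := fun w => tlsub (f w) (g w).

Let measurable_tlinv_comp f : measurable_fun [set: T] (tlinv \o f : T -> R).
Proof. exact: measurableT_comp measurable_tlinv (measurable_funPT f). Qed.

Lemma measurable_rv_add f g : measurable_fun [set: T] (rv_add f g).
Proof.
exact: (measurableT_comp measurable_tl
  (measurable_funD (measurable_tlinv_comp f) (measurable_tlinv_comp g))).
Qed.

Lemma measurable_rv_scale a f : measurable_fun [set: T] (rv_scale a f).
Proof.
exact: (measurableT_comp measurable_tl
  (measurable_funM (measurable_cst a) (measurable_tlinv_comp f))).
Qed.

Lemma measurable_rv_sub f g : measurable_fun [set: T] (rv_sub f g).
Proof.
exact: (measurableT_comp measurable_tl
  (measurable_funB (measurable_tlinv_comp f) (measurable_tlinv_comp g))).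
Qed.

HB.instance Definition _ f g :=
  isMeasurableFun.Build _ _ _ _ (rv_add f g) (measurable_rv_add f g).
HB.instance Definition _ a f :=
  isMeasurableFun.Build _ _ _ _ (rv_scale a f) (measurable_rv_scale a f).
HB.instance Definition _ f g :=
  isMeasurableFun.Build _ _ _ _ (rv_sub f g) (measurable_rv_sub f g).

End random_variables.

Section noise.
Context {R : realType} {d : measure_display} {T : measurableType d}.
Variables (P : probability T R) (q : nat).
Implicit Types (Y : {RV P >-> R}).
Implicit Types (Z : 'I_q -> {RV P >-> R}).

Definition mutually_independent Z : Prop :=
  forall (J : {set 'I_q}) (B : 'I_q -> set R),
    (forall j, measurable (B j)) ->
    P (\bigcap_(j in [set` J]) (Z j @^-1` B j)) =
    (\prod_(j in J) P (Z j @^-1` B j))%E.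

Definition unit_scale_tail (alpha : R) (b : R -> R) Y : Prop :=
  forall x : R, 0 < x ->
    (s%:E * P [set w | (x * b s < Y w)%R])%E @[s --> +oo%R]
      --> ((x `^ (- alpha))%:E : \bar R).

Definition lower_tail (b : R -> R) Y : Prop :=
  forall c : R, c < 0 ->
    (s%:E * P [set w | (Y w <= expR (c * b s))%R])%E @[s --> +oo%R]
      --> (0%E : \bar R).

End noise.

Section space.
Context {R : realType} {d : measure_display} {T : measurableType d}.
Variable P : probability T R.

(* Random variables up to almost sure equality. *)
Local Notation L0 := {mfun_ P, T >-> R}.
Implicit Types (X Y : L0).

(* The operations are pointwise on representatives; the class of the result
   does not depend on the representatives chosen. *)
Definition rvc_add X Y : L0 := \pi [mfun of rv_add (repr X) (repr Y)].
Definition rvc_scale (a : R) X : L0 := \pi [mfun of rv_scale a (repr X)].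
Definition rvc_sub X Y : L0 := \pi [mfun of rv_sub (repr X) (repr Y)].

(* The neutral element of [rvc_add], on classes of positive random variables:
   [tladd x (tl 0) = x] for [0 < x]. *)
Definition rvc_zero : L0 := \pi [mfun of cst (tl 0)].

Definition tlcomb n (a : 'rV[R]_n) (X : 'I_n -> L0) : L0 :=
  \big[rvc_add/rvc_zero]_(i < n) rvc_scale (a 0 i) (X i).

Lemma repr_pi_ae (f : {mfun T >-> R}) : (repr (\pi_L0 f) : T -> R) = f %[ae P].
Proof. by have /eqmodP/asboolP := reprK (\pi_L0 f). Qed.

Lemma tlcomb_ae n (a : 'rV[R]_n) (X : 'I_n -> L0) :
  (repr (tlcomb a X) : T -> R) =
    (fun w => tl (\sum_(i < n) a 0 i * tlinv (repr (X i) w))) %[ae P].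
Proof.
rewrite /tlcomb; elim: (index_enum _) => [|i r H].
  rewrite big_nil; apply: filterS (repr_pi_ae [mfun of cst (tl 0)]) => w H1 _.
  by rewrite (H1 I) big_nil.
rewrite big_cons; set Y := bigop.body _ _ _ in H *.
apply: filterS3
  (repr_pi_ae [mfun of rv_add (repr (rvc_scale (a 0 i) (X i))) (repr Y)])
  (repr_pi_ae [mfun of rv_scale (a 0 i) (repr (X i))]) H => w H1 H2 H _.
rewrite (H1 I)/= /rv_add (H2 I) (H I) /=.
by rewrite /rv_scale /tladd /tlscale !tlK big_cons.
Qed.

Definition tlspan n (X : 'I_n -> L0) : set L0 :=
  [set Y | exists a : 'rV[R]_n, Y = tlcomb a X].

Variables (q : nat) (Z : 'I_q -> {RV P >-> R}).

Definition noise_class (j : 'I_q) : L0 := \pi [mfun of Z j].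

Definition Vq : set L0 := tlspan noise_class.

(* The coefficient vector of an element of [Vq], which is unique for the noise
   vectors considered here; a dummy value outside of [Vq]. *)
Definition coef X : 'rV[R]_q := xget 0 [set a | X = tlcomb a noise_class].

Definition inner X Y : R := \sum_(j < q) coef X 0 j * coef Y 0 j.

Definition normV X : R := Num.sqrt (inner X X).

Definition orthoV (V : set L0) : set L0 :=
  [set X | Vq X /\ forall Y, V Y -> inner X Y = 0].

End space.

(* Main.v *)
(** If [sum_j c_j tlinv(Z_j) = 0] almost surely, then [c = 0]: were [c_k <> 0],
    independence and the unboundedness of [Z_k] would give positive probability
    to an event on which the [k]-th term dominates all the others.  Hence [Vq]
    is isometric to ['rV_q] with the usual dot product, [V_A] corresponds to the
    row space of the matrix of the [a_i], and the claim is the projection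
    theorem there, obtained from the normal equations and Pythagoras. *)
Require Import Defs.
From mathcomp Require Import all_boot all_order all_algebra.
From mathcomp Require Import all_classical all_reals all_analysis.
Import Order.TTheory GRing.Theory Num.Theory.
Import numFieldNormedType.Exports.
Local Open Scope classical_set_scope.
Local Open Scope ring_scope.

(** * Orthogonal projection onto a row space *)

Section projection.
Context {R : realType} {q : nat}.
Implicit Types u v x y : 'rV[R]_q.

(** A matrix product, so that orthogonality to every row of [A] is the single equation
    [u *m A^T = 0]. *)
Definition dotv u v : R := (u *m v^T) 0 0.

Lemma dotvE u v : dotv u v = \sum_j u 0 j * v 0 j.
Proof. by rewrite /dotv mxE; apply: eq_bigr => j _; rewrite mxE. Qed.

Lemma dotv_ge0 u : 0 <= dotv u u.
Proof. by rewrite dotvE sumr_ge0// => j _; rewrite -expr2 sqr_ge0. Qed.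

Lemma dotv_eq0 u : dotv u u = 0 -> u = 0.
Proof.
rewrite dotvE => /eqP; rewrite psumr_eq0; last first.
  by move=> j _; rewrite -expr2 sqr_ge0.
move=> /allP u0; apply/rowP => j; rewrite mxE.
by have := u0 j (mem_index_enum j); rewrite -expr2 sqrf_eq0 => /eqP.
Qed.

Lemma dotv_pythagoras u v : dotv u v = 0 ->
  dotv (u + v) (u + v) = dotv u u + dotv v v.
Proof.
move=> uv; have vu : dotv v u = 0.
  by rewrite -uv !dotvE; apply: eq_bigr => j _; rewrite mulrC.
rewrite /dotv linearD /= mulmxDl !mulmxDr 3!mxE -/(dotv u u) -/(dotv u v).
by rewrite [X in _ + X]mxE -/(dotv v u) -/(dotv v v) uv vu addr0 add0r.
Qed.

(** The diagonal entries of [M *m M^T] are the squared norms of the rows of [M]. *)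
Lemma mulmx_tr_eq0 {m : nat} (M : 'M[R]_(m, q)) : M *m M^T = 0 -> M = 0.
Proof.
move=> MM; apply/row_matrixP => i; rewrite row0; apply: dotv_eq0.
have := congr1 (fun B : 'M[R]_m => B i i) MM; rewrite dotvE !mxE => MMi.
by rewrite -[RHS]MMi; apply: eq_bigr => j _; rewrite !mxE.
Qed.

(* The normal equations [x A^T = c A A^T] are always solvable, because [A A^T]
   and [A^T] have the same kernel. *)
Lemma exists_orthogonal_projection {p : nat} (A : 'M[R]_(p, q)) x :
  exists c : 'rV_p, (x - c *m A) *m A^T = 0.
Proof.
have /submxP[c xA] : (x *m A^T <= A *m A^T)%MS.
  rewrite submxE -mulmxA; set C := cokermx _.
  suff -> : A^T *m C = 0 by rewrite mulmx0.
  (* With [M = C^T *m A], [M *m M^T] is [C^T *m (A *m A^T *m C)], which vanishes since [C] is the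
     cokernel of [A *m A^T]. *)
  apply: trmx_inj; rewrite trmx0; apply: mulmx_tr_eq0.
  by rewrite trmxK trmx_mul trmxK -mulmxA (mulmxA A) mulmx_coker mulmx0.
by exists c; rewrite mulmxBl xA mulmxA subrr.
Qed.

(** Pythagoras: [x - c' *m A] splits into the residual [x - c *m A] and a vector of the row space,
    orthogonal to it. The equality case compares [c' *m A] with [c *m A], not [c'] with [c], because
    the rows of [A] may be dependent. *)
Lemma orthogonal_projection_le {p : nat} (A : 'M[R]_(p, q)) x c c' :
    (x - c *m A) *m A^T = 0 ->
  Num.sqrt (dotv (x - c *m A) (x - c *m A)) <=
    Num.sqrt (dotv (x - c' *m A) (x - c' *m A))
    ?= iff (c' *m A == c *m A).
Proof.
move=> xA0; set r := x - c *m A in xA0 *.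
have -> : x - c' *m A = r + (c - c') *m A.
  by rewrite mulmxBl /r addrA subrK.
rewrite dotv_pythagoras; last by rewrite /dotv trmx_mul mulmxA xA0 mul0mx mxE.
split; first by rewrite ler_wsqrtr// lerDl dotv_ge0.
rewrite eqr_sqrt ?addr_ge0 ?dotv_ge0// -[X in X == _]addr0.
rewrite (inj_eq (addrI _)) eq_sym [RHS]eq_sym -[RHS]subr_eq0 -mulmxBl.
by apply/eqP/eqP => [/dotv_eq0//|->]; rewrite /dotv mul0mx mxE.
Qed.

End projection.

(** * Linear independence of the transformed noise *)

Section noise.
Context {R : realType} {d : measure_display} {T : measurableType d}.
Variable P : probability T R.

(** Otherwise [s * P(Y > b s)] would vanish as soon as [b s > K], whereas the tail condition at 1
    makes it tend to 1. *)
Lemma unit_scale_tail_unbounded alpha (b : R -> R) (Y : {RV P >-> R}) (K : R) :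
  b s @[s --> +oo] --> +oo -> unit_scale_tail alpha b Y ->
  P [set w | K < Y w] != 0%E.
Proof.
move=> b_infty /(_ 1 ltr01); rewrite powR1 => Y1; apply/eqP => PK0.
have mY (r : R) : measurable [set w | r < Y w].
  rewrite (_ : [set w | _] = Y @^-1` `]r, +oo[); last first.
    by apply/seteqP; split => w /=; rewrite in_itv/= andbT.
  by rewrite -[X in measurable X]setTI; exact: measurable_funPT.
have : (s%:E * P [set w | (1 * b s < Y w)%R])%E @[s --> +oo] --> (0%E : \bar R).
  apply: cvg_near_cst; near=> s.
  rewrite mul1r (_ : P _ = 0%E) ?mule0//; apply/eqP.
  rewrite eq_le measure_ge0 andbT -PK0 le_measure ?inE//.
  move=> w /=; apply: lt_trans.
  by near: s; apply: cvgry_gt.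
move=> /(cvg_unique _ Y1) => /(_ (@ereal_hausdorff R)) [] /eqP.
by rewrite oner_eq0.
Unshelve. all: by end_near. Qed.

(** The events [|f| <= n] cover the whole space, so they cannot all be negligible. *)
Lemma bounded_nonnegligible (f : T -> R) : measurable_fun [set: T] f ->
  exists M, P [set w | `|f w| <= M] != 0%E.
Proof.
move=> mf; apply: contrapT => /forallNP f0.
have : P.-negligible (\bigcup_n [set w | `|f w| <= n%:R]).
  apply: negligible_bigcup => n; apply/negligibleP.
    rewrite -[X in measurable X]setTI.
    rewrite (_ : [set w | _] = f @^-1` `[-n%:R, n%:R]); first exact: mf.
    by apply/seteqP; split => w /=; rewrite in_itv/= ler_norml.
  by apply/eqP/negPn/negP; exact: f0.
rewrite (_ : \bigcup_n _ = setT).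
  move=> /(proj1 (negligibleP P measurableT)) PT0.
  have /eqP := etrans (esym (probability_setT P)) PT0.
  by rewrite onee_eq0.
apply/seteqP; split => // w _; exists (Num.truncn `|f w|).+1 => //=.
by rewrite ltW// truncnS_gt.
Qed.

Context {q : nat}.
Variable Z : 'I_q -> {RV P >-> R}.

Lemma noise_linearly_independent (alpha : R) (b : R -> R) (c : 'rV[R]_q) :
  mutually_independent Z -> b s @[s --> +oo] --> +oo ->
  (forall j, unit_scale_tail alpha b (Z j)) ->
  (\forall w \ae P, \sum_j c 0 j * tlinv (Z j w) = 0) -> c = 0.
Proof.
move=> Z_indep b_infty Z_tail c0; apply/rowP => k; rewrite mxE.
apply/eqP/negPn/negP => ck.
have mY j : measurable_fun [set: T] (fun w => tlinv (Z j w)).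
  exact: measurableT_comp measurable_tlinv (measurable_funPT (Z j)).
have /choice[M PM] := fun j => bounded_nonnegligible _ (mY j).
(* [N] bounds the sum of the terms other than the [k]-th when each [tlinv (Z j)] stays within [M j];
   [B k] forces the [k]-th term to exceed [N] in absolute value. *)
pose N := \sum_(j | j != k) `|c 0 j| * M j.
pose B j : set R := if j == k then `]tl (N / `|c 0 k|), +oo[%classic
  else tlinv @^-1` `[- M j, M j].
have mB j : measurable (B j).
  rewrite /B; case: ifP => _ //.
  rewrite -[X in measurable X]setTI; exact: measurable_tlinv.
have PB j : P (Z j @^-1` B j) != 0%E.
  rewrite /B; case: (eqVneq j k) => [->|_].
    have := unit_scale_tail_unbounded _ _ _ (tl (N / `|c 0 k|)) b_infty (Z_tail k).
    congr (P _ != _); apply/seteqP; split => w /=; by rewrite in_itv/= andbT.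
  have := PM j; congr (P _ != _).
  by apply/seteqP; split => w /=; rewrite in_itv/= ler_norml.
(* Independence turns this probability into a product of nonzero factors. *)
have : P (\bigcap_(j in [set` [set: 'I_q]%SET]) (Z j @^-1` B j)) != 0%E.
  rewrite Z_indep//; apply: (big_ind (fun y : \bar R => y != 0%E)) => //.
by move=> y z y0 z0; rewrite mule_neq0.
move=> /negP; apply; apply/eqP; apply/negligibleP.
  apply: fin_bigcap_measurable => // j _.
  by rewrite -[X in measurable X]setTI; exact: measurable_funPT.
(* It remains to see that the sum is nonzero everywhere on the intersection. *)
apply: negligibleS c0 => w wB /= /eqP.
have wBj j : B j (Z j w) by apply: wB; rewrite /= inE.
rewrite (bigD1 k)//= addr_eq0 => /eqP ckE.
have : `|c 0 k * tlinv (Z k w)| <= N.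
  rewrite ckE normrN (le_trans (ler_norm_sum _ _ _))// ler_sum// => j jk.
  rewrite normrM ler_wpM2l//; have := wBj j.
  by rewrite /B (negbTE jk) /= in_itv/= ler_norml.
apply/negP; rewrite -ltNge normrM mulrC -ltr_pdivrMr ?normr_gt0//.
apply: lt_le_trans (ler_norm _).
have := wBj k; rewrite /B eqxx /= in_itv/= andbT => Zk.
(* [tlinv] is strictly increasing on positive reals; positivity of [tl] keeps both arguments of [ln]
   positive. *)
rewrite -(tlK (N / _)) /tlinv.
have := tl_gt0 (N / `|c 0 k|) => t0.
by rewrite ltr_ln ?ltrD2r ?ltr_expR// posrE subr_gt0 expR_gt1// (lt_trans t0).
Qed.

End noise.

(** * Coordinates on [Vq] *)

Section classes.
Context {R : realType} {d : measure_display} {T : measurableType d}.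
Context {P : probability T R}.

Lemma mfun_class_eq (X Y : {mfun_ P, T >-> R}) :
  (repr X : T -> R) = repr Y %[ae P] -> X = Y.
Proof.
move=> XY; rewrite -[X]reprK -[Y]reprK.
by apply/eqmodP/asboolP.
Qed.

Context {q : nat}.
Variable Z : 'I_q -> {RV P >-> R}.
Local Notation comb x := (tlcomb x (noise_class Z)).

Lemma noise_comb_ae (x : 'rV[R]_q) :
  (repr (comb x) : T -> R) =
    (fun w => tl (\sum_j x 0 j * tlinv (Z j w))) %[ae P].
Proof.
(* There are finitely many indices, so one negligible set serves them all. *)
have : \forall w \ae P, forall j, repr (noise_class Z j) w = Z j w.
  apply: filter_forall => j.
  by apply: filterS (repr_pi_ae P (Z j)) => w; exact.
apply: filterS2 (tlcomb_ae x (noise_class Z)) => w xw Zw _.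
by rewrite (xw I); congr (tl _); apply: eq_bigr => j _; rewrite Zw.
Qed.

Lemma noise_comb_sub (x y : 'rV[R]_q) :
  rvc_sub (comb x) (comb y) = comb (x - y).
Proof.
apply: mfun_class_eq.
have xyE := repr_pi_ae P [mfun of rv_sub (repr (comb x)) (repr (comb y))].
apply: filterS3 (filterI (noise_comb_ae x) (noise_comb_ae y))
  (noise_comb_ae (x - y)) xyE.
move=> w [xw yw] xyw /(_ I) sw _; rewrite sw/= /rv_sub (xw I) (yw I) (xyw I).
rewrite /tlsub !tlK -sumrB; congr (tl _).
by apply: eq_bigr => j _; rewrite !mxE mulrBl.
Qed.

(** Identifies the span of the [X_i] with the row space of the matrix whose rows are the [a i]. *)
Lemma tlcomb_noise_comb {p : nat} (c : 'rV[R]_p) (a : 'I_p -> 'rV[R]_q) :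
  tlcomb c (fun i => comb (a i)) = comb (c *m \matrix_i a i).
Proof.
apply: mfun_class_eq.
have aw : \forall w \ae P, forall i, repr (comb (a i)) w =
    tl (\sum_j a i 0 j * tlinv (Z j w)).
  by apply: filter_forall => i; apply: filterS (noise_comb_ae (a i)) => w; exact.
apply: filterS3 (tlcomb_ae c (fun i => comb (a i)))
  (noise_comb_ae (c *m \matrix_i a i)) aw.
move=> w cw mw {}aw _; rewrite (cw I) (mw I); congr (tl _).
under eq_bigr do rewrite aw tlK mulr_sumr.
rewrite exchange_big; apply: eq_bigr => j _; rewrite mxE mulr_suml.
by apply: eq_bigr => i _; rewrite mxE mulrA.
Qed.

Hypothesis Z_free : forall c : 'rV[R]_q,
  (\forall w \ae P, \sum_j c 0 j * tlinv (Z j w) = 0) -> c = 0.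

Lemma noise_comb_inj : injective (fun x : 'rV[R]_q => comb x).
Proof.
move=> x y /= xy; apply/eqP; rewrite -subr_eq0; apply/eqP/Z_free.
apply: filterS2 (noise_comb_ae x) (noise_comb_ae y) => w xw yw.
have : tl (\sum_j x 0 j * tlinv (Z j w)) = tl (\sum_j y 0 j * tlinv (Z j w)).
  by rewrite -(xw I) -(yw I) xy.
move=> /(can_inj tlK)/eqP; rewrite -subr_eq0 -sumrB => /eqP xy0; rewrite -[RHS]xy0.
by apply: eq_bigr => j _; rewrite !mxE mulrBl.
Qed.

(** By injectivity, the set from which [xget] chooses is a singleton. *)
Lemma coef_noise_comb (x : 'rV[R]_q) : coef Z (comb x) = x.
Proof. by apply: xget_subset1 => // u v /= -> /noise_comb_inj. Qed.

Lemma inner_noise_comb (x y : 'rV[R]_q) : inner Z (comb x) (comb y) = dotv x y.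
Proof. by rewrite /inner !coef_noise_comb dotvE. Qed.

End classes.

(** * Transfer of the projection theorem to [Vq] *)

Theorem theorem1 (R : realType) (d : measure_display) (T : measurableType d)
    (P : probability T R) (p q : nat) (alpha : R) (b : R -> R)
    (Z : 'I_q -> {RV P >-> R}) (a : 'I_p -> 'rV[R]_q)
    (p_gt0 : (0 < p)%N) (p_lt_q : (p < q)%N)
    (alpha_gt0 : 0 < alpha)
    (Z_indep : mutually_independent Z)
    (Z_ge0 : forall j w, 0 <= Z j w)
    (b_infty : b s @[s --> +oo] --> +oo)
    (Z_tail : forall j, unit_scale_tail alpha b (Z j))
    (Z_lower : forall j, lower_tail b (Z j)) :
  let VA := tlspan (fun i : 'I_p => tlcomb (a i) (noise_class Z)) in
  forall X, Vq Z X ->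
    (exists! Xhat, VA Xhat /\
       normV Z (rvc_sub X Xhat) = inf [set normV Z (rvc_sub X Y) | Y in VA]) /\
    (forall Xhat,
       (VA Xhat /\
        normV Z (rvc_sub X Xhat) = inf [set normV Z (rvc_sub X Y) | Y in VA])
       <-> (VA Xhat /\ orthoV Z VA (rvc_sub X Xhat))).
Proof.
move=> VA X [x ->].
have Z_free c := noise_linearly_independent P Z alpha b c Z_indep b_infty Z_tail.
pose A := \matrix_i a i.
pose comb (v : 'rV[R]_q) := tlcomb v (noise_class Z).
have VAP Y : VA Y <-> exists c, Y = comb (c *m A).
  by split=> -[c ->]; exists c; rewrite tlcomb_noise_comb.
have normE (v : 'rV[R]_q) :
    normV Z (rvc_sub (comb x) (comb v)) = Num.sqrt (dotv (x - v) (x - v)).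
  by rewrite noise_comb_sub /normV inner_noise_comb.
set m := inf _.
(* Stated for every solution [c] of the normal equations: one solution gives existence and
   uniqueness, an arbitrary one gives the converse in (2). *)
have minP c : (x - c *m A) *m A^T = 0 ->
    forall Y, VA Y /\ normV Z (rvc_sub (comb x) Y) = m <-> Y = comb (c *m A).
  move=> xA0.
  (* The value at [c *m A] belongs to [S] and bounds it below, so [S] has a genuine infimum and
     attains it there. *)
  have mE : m = normV Z (rvc_sub (comb x) (comb (c *m A))).
    pose S := [set normV Z (rvc_sub (comb x) Y) | Y in VA].
    have Sc : S (normV Z (rvc_sub (comb x) (comb (c *m A)))).
      by exists (comb (c *m A)) => //; apply/VAP; exists c.
    have lbS : lbound S (normV Z (rvc_sub (comb x) (comb (c *m A)))).
      move=> _ [Y /VAP[c' ->] <-]; rewrite !normE.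
      exact: (orthogonal_projection_le A x c c' xA0).
    apply/eqP; rewrite eq_le; apply/andP; split.
      by apply: ge_inf => //; eexists; exact: lbS.
    by apply: lb_le_inf => //; eexists; exact: Sc.
  move=> Y; split=> [[/VAP[c' ->]]|->]; last first.
    by split; [apply/VAP; exists c|rewrite mE].
  rewrite mE !normE => /esym/eqP.
  by rewrite (orthogonal_projection_le A x c c' xA0) => /eqP ->.
have orthoP c : orthoV Z VA (rvc_sub (comb x) (comb (c *m A))) <->
    (x - c *m A) *m A^T = 0.
  rewrite noise_comb_sub; split=> [[_ xA]|xA].
    apply/rowP => i; rewrite [RHS]mxE.
    (* Testing orthogonality against the generator [X_i] yields the [i]-th normal equation. *)
    have /xA : VA (comb (delta_mx 0 i *m A)) by apply/VAP; eexists.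
    rewrite inner_noise_comb// /dotv trmx_mul mulmxA trmx_delta -colE => <-.
    by rewrite [RHS]mxE.
  split; first by exists (x - c *m A).
  move=> _ /VAP[c' ->]; rewrite inner_noise_comb// /dotv trmx_mul mulmxA xA.
  by rewrite mul0mx mxE.
have [c0 c0P] := exists_orthogonal_projection A x; split.
  exists (comb (c0 *m A)); split; first exact/(minP _ c0P).
  by move=> Y /(minP _ c0P).
move=> Y; split=> [[VAY]|[/VAP[c ->] /orthoP cP]]; last exact/(minP _ cP).
move=> Ym; split => //.
by have /(minP _ c0P) -> := conj VAY Ym; apply/orthoP.
Qed.
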